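(* Let $H$ be an infinite countable group, $\Sigma<H$ a finite subgroup and $\theta:\Sigma\rightarrow H$ an injective group homomorphism. If both $\Sigma$ and $\theta(\Sigma)$ are highly core-free in $H$, then the HNN extension $\mathrm{HNN}(H,\Sigma,\theta)$ belongs to $\mathcal{H}_{\mathcal R}$.
   Context: Graphs are simple and undirected. The Random Graph $\mathcal R$ is the unique (up to isomorphism) countably infinite graph such that for all disjoint finite sets $U,W$ of vertices there is a vertex $z\notin U\cup W$ adjacent to every vertex of $U$ and to no vertex of $W$. An action of a group $\Gamma$ on $\mathcal R$ is a homomorphism $\Gamma\to\mathrm{Aut}(\mathcal R)$. It is homogeneous if for every graph isomorphism $\varphi:U\to W$ between finite induced subgraphs of $\mathcal R$ there is $g\in\Gamma$ with $g u=\varphi(u)$ for all $u\in U$. $\mathcal H_{\mathcal R}$ denotes the class of all countable groups admitting a faithful and homogeneous action on $\mathcal R$. $\mathrm{HNN}(H,\Sigma,\theta)$ is the group generated by $H$ and a letter $t$ subject to the relations of $H$ and $t\sigma t^{-1}=\theta(\sigma)$ for all $\sigma\in\Sigma$. For a subgroup $\Sigma<\Gamma$ and a non-empty subset $S\subset\Gamma$, put $\mathrm{Core}_S(\Sigma)=\bigcap_{h\in S}h^{-1}\Sigma h$. The subgroup $\Sigma$ is highly core-free in $\Gamma$ if for every finite subset $F\subset\Gamma$, every $n\geq 1$ and all non-empty subsets $S_1,\dots,S_n\subset\Gamma$ with $\Gamma\setminus\Sigma F\subset\bigcup_{k=1}^n S_k$, there is $k\in\{1,\dots,n\}$ with $\mathrm{Core}_{S_k}(\Sigma)=\{1\}$.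 *)

(* Defs.v *)
From HB Require Import structures.
From mathcomp Require Import all_boot.
From mathcomp Require Import boolp classical_sets functions cardinality.

Set Implicit Arguments.
Unset Strict Implicit.
Unset Printing Implicit Defensive.

Local Open Scope classical_set_scope.
Local Open Scope group_scope.
Local Open Scope quotient_scope.
Local Open Scope card_scope.

Definition subgroup (G : groupType) (S : set G) : Prop :=
  S 1 /\ (forall x y, S x -> S y -> S (x * y^-1)).

Definition core (G : groupType) (S Sigma : set G) : set G :=
  \bigcap_(h in S) [set h^-1 * s * h | s in Sigma].

Definition highly_core_free (G : groupType) (Sigma : set G) : Prop :=
  forall (F : set G) (n : nat) (S : 'I_n -> set G),
    finite_set F -> (1 <= n)%N -> (forall k, S k !=set0) ->
    ~` [set s * f | s in Sigma & f in F] `<=` \bigcup_k S k ->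
    exists k, core (S k) Sigma = [set 1].

(* HNN(H, Sigma, theta) is presented as a monoid: words in the elements of H,
   t and t^-1, modulo the least congruence containing the multiplication table
   of H, the cancellations of t with t^-1 and the relations
   t s t^-1 = theta s.  Only the values of theta on Sigma are used. *)
Section HNN.
Variables (H : groupType) (Sigma : set H) (theta : H -> H).

(* [inl h] is h, [inr true] is t, [inr false] is t^-1. *)
Definition hnn_word := seq (H + bool).

Inductive hnn_cong : hnn_word -> hnn_word -> Prop :=
| hnn_refl u : hnn_cong u u
| hnn_sym u v : hnn_cong u v -> hnn_cong v u
| hnn_trans v u w : hnn_cong u v -> hnn_cong v w -> hnn_cong u w
| hnn_cat u u' v v' :
    hnn_cong u u' -> hnn_cong v v' -> hnn_cong (u ++ v) (u' ++ v')
| hnn_one : hnn_cong [:: inl 1] [::]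
| hnn_mul x y : hnn_cong [:: inl x; inl y] [:: inl (x * y)]
| hnn_tK : hnn_cong [:: inr true; inr false] [::]
| hnn_tVK : hnn_cong [:: inr false; inr true] [::]
| hnn_conj s : Sigma s ->
    hnn_cong [:: inr true; inl s; inr false] [:: inl (theta s)].

Definition hnn_rel : rel hnn_word := fun u v => `[< hnn_cong u v >].

Lemma hnn_rel_refl : reflexive hnn_rel.
Proof. by move=> u; apply/asboolP; exact: hnn_refl. Qed.

Lemma hnn_rel_sym : symmetric hnn_rel.
Proof. by move=> u v; apply/asboolP/asboolP; exact: hnn_sym. Qed.

Lemma hnn_rel_trans : transitive hnn_rel.
Proof. by move=> v u w /asboolP uv /asboolP vw; apply/asboolP/(hnn_trans uv vw). Qed.

Canonical hnn_equiv := EquivRel hnn_rel hnn_rel_refl hnn_rel_sym hnn_rel_trans.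

Definition hnn := {eq_quot hnn_equiv}.
HB.instance Definition _ := Choice.on hnn.

Lemma hnn_piP (u v : hnn_word) : \pi_hnn u = \pi_hnn v <-> hnn_cong u v.
Proof.
split=> [/eqP|uv]; first by rewrite piE => /asboolP.
by apply/eqP; rewrite piE; apply/asboolP.
Qed.

Definition hnn_letter_inv (a : H + bool) : H + bool :=
  match a with inl h => inl h^-1 | inr b => inr (~~ b) end.

Definition hnn_word_inv (u : hnn_word) : hnn_word := rev (map hnn_letter_inv u).

Definition hnn_one_op : hnn := \pi_hnn [::].
Definition hnn_mul_op (x y : hnn) : hnn := \pi_hnn (repr x ++ repr y).
Definition hnn_inv_op (x : hnn) : hnn := \pi_hnn (hnn_word_inv (repr x)).

Lemma hnn_repr u : hnn_cong (repr (\pi_hnn u)) u.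
Proof. by apply/hnn_piP; rewrite reprK. Qed.

Lemma hnn_mul_pi u v : hnn_mul_op (\pi_hnn u) (\pi_hnn v) = \pi_hnn (u ++ v).
Proof. by apply/hnn_piP; apply: hnn_cat; exact: hnn_repr. Qed.

Lemma hnn_word_invK : involutive hnn_word_inv.
Proof.
move=> u; rewrite /hnn_word_inv map_rev revK -map_comp -[RHS]map_id.
by apply: eq_map => -[h|b] /=; rewrite ?invgK ?negbK.
Qed.

Lemma hnn_word_mulVg u : hnn_cong (hnn_word_inv u ++ u) [::].
Proof.
elim: u => [|a u IHu]; first exact: hnn_refl.
rewrite /hnn_word_inv map_cons rev_cons cat_rcons -/(hnn_word_inv u).
apply: hnn_trans IHu; apply: hnn_cat; first exact: hnn_refl.
suff aK : hnn_cong [:: hnn_letter_inv a; a] [::].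
  exact: hnn_cat aK (hnn_refl u).
case: a => [h|[]] /=; [|exact: hnn_tVK|exact: hnn_tK].
by apply: hnn_trans (hnn_mul _ _) _; rewrite mulVg; exact: hnn_one.
Qed.

Lemma hnn_opA : associative hnn_mul_op.
Proof.
move=> x y z; rewrite -[x]reprK -[y]reprK -[z]reprK.
by rewrite (hnn_mul_pi (repr y)) (hnn_mul_pi (repr x) (repr y)) !hnn_mul_pi catA.
Qed.

Lemma hnn_op1g : left_id hnn_one_op hnn_mul_op.
Proof. by move=> x; rewrite -[x]reprK hnn_mul_pi. Qed.

Lemma hnn_opg1 : right_id hnn_one_op hnn_mul_op.
Proof. by move=> x; rewrite -[x]reprK hnn_mul_pi cats0. Qed.

Lemma hnn_opVg : left_inverse hnn_one_op hnn_inv_op hnn_mul_op.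
Proof.
move=> x; rewrite -[X in hnn_mul_op _ X]reprK hnn_mul_pi.
exact/hnn_piP/hnn_word_mulVg.
Qed.

Lemma hnn_opgV : right_inverse hnn_one_op hnn_inv_op hnn_mul_op.
Proof.
move=> x; rewrite -[X in hnn_mul_op X _]reprK hnn_mul_pi.
by apply/hnn_piP; rewrite -{1}[repr x]hnn_word_invK; exact: hnn_word_mulVg.
Qed.

HB.instance Definition _ :=
  isGroup.Build hnn hnn_opA hnn_op1g hnn_opg1 hnn_opVg hnn_opgV.

End HNN.

Record simple_graph := SimpleGraph {
  vertex :> Type;
  adj : vertex -> vertex -> Prop;
  adj_sym : forall x y, adj x y -> adj y x;
  adj_irr : forall x, ~ adj x x
}.

Definition is_random_graph (R : simple_graph) : Prop :=
  [set: R] #= [set: nat] /\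
  forall U W : set R, finite_set U -> finite_set W -> U `&` W = set0 ->
    exists z, [/\ ~ (U `|` W) z, forall u, U u -> adj z u
                & forall w, W w -> ~ adj z w].

Section Actions.
Variables (G : groupType) (R : simple_graph) (act : G -> R -> R).

(* The two composition laws make each [act g] bijective, so [act] is a
   homomorphism from G to Aut(R). *)
Definition is_graph_action : Prop :=
  [/\ forall x, act 1 x = x,
      forall g h x, act (g * h) x = act g (act h x)
    & forall g x y, adj (act g x) (act g y) <-> adj x y].

Definition faithful_action : Prop :=
  forall g, (forall x, act g x = x) -> g = 1.

Definition homogeneous_action : Prop :=
  forall (U W : set R) (phi : R -> R),
    finite_set U -> finite_set W -> set_bij U W phi ->
    (forall x y, U x -> U y -> (adj (phi x) (phi y) <-> adj x y)) ->
    exists g, forall u, U u -> act g u = phi u.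

End Actions.

(* [is_random_graph] determines R up to isomorphism and the remaining
   conditions are invariant under isomorphism, so it is immaterial which
   model of the Random Graph is acted upon. *)
Definition in_HR (G : groupType) : Prop :=
  countable [set: G] /\
  exists (R : simple_graph) (act : G -> R -> R),
    [/\ is_random_graph R, is_graph_action act, faithful_action act
      & homogeneous_action act].

(* Main.v *)
(* Let H act by left translation on the vertex set H * nat, and choose the
   H-invariant edges so that the graph is random while every vertex has, modulo
   translation, only finitely many translates of a given vertex as neighbours.
   An automorphism w with w o s = theta s o w for s in Sigma makes this an action
   of the HNN extension, t acting as w.  Such a w is built as an increasing union
   of finite equivariant partial isomorphisms, meeting countably many
   requirements.
   - Homogeneity: given a finite partial isomorphism phi, high core-freeness
     yields h, k in H such that the translates by h of dom phi, and by k of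
     the range of phi, are far from everything used so far and have mutually
     far Sigma- (resp. theta(Sigma)-) translates; w can then be made to send
     h u to k (phi u), so k^-1 t h extends phi.
   - Faithfulness: a reduced word moves some point, since each of its letters
     t, t^-1 can be made to lead to a point in a new H-orbit. *)

Require Import Defs.
From HB Require Import structures.
From mathcomp Require Import all_boot.
From mathcomp Require Import boolp classical_sets functions cardinality.

Set Implicit Arguments.
Unset Strict Implicit.
Unset Printing Implicit Defensive.

Local Open Scope classical_set_scope.
Local Open Scope group_scope.
Local Open Scope quotient_scope.

(* [true] stands for t and the domains of partial isomorphisms, [false] for
   t^-1 and their ranges. *)
Definition side (X : Type) (b : bool) (p : X * X) : X := if b then p.1 else p.2.

Definition mkpair (X : Type) (b : bool) (x y : X) : X * X :=
  if b then (x, y) else (y, x).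

Lemma side_mkpair (X : Type) b (x y : X) : side b (mkpair b x y) = x.
Proof. by case: b. Qed.

Lemma side_mkpairN (X : Type) b (x y : X) : side (~~ b) (mkpair b x y) = y.
Proof. by case: b. Qed.

(** * Extension of finite equivariant partial isomorphisms *)

Section PartialIsomorphisms.
Variables (H : groupType) (R : choiceType) (a : H -> R -> R) (E : rel R).
(* To be instantiated by the graph of theta on Sigma. *)
Variable T : seq (H * H).
Hypothesis a1 : forall x, a 1 x = x.
Hypothesis aM : forall g h x, a (g * h) x = a g (a h x).
Hypothesis a_free : forall g x, a g x = x -> g = 1.
Hypothesis E_sym : symmetric E.
Hypothesis E_act : forall g x y, E (a g x) (a g y) = E x y.
Hypothesis E_irr : irreflexive E.
Hypothesis E_fin : forall u v,
  exists F : seq H, forall h, (a h u == v) || E (a h u) v -> h \in F.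
(** The last clause prescribes the edges inside the orbit of [z]: an equivariant map sending [x] to
    [z] has to match the edges between [x] and its translates. The condition on [P] is symmetrised
    because [E] is symmetric. *)
Hypothesis E_ext : forall (U V : seq R) (P : seq H), exists z,
  [/\ forall v h, v \in V -> a h z != v,
      forall v, v \in V -> E z v = (v \in U)
    & forall h, E z (a h z) = (h != 1) && ((h \in P) || (h^-1 \in P))].
Hypothesis T1 : (1, 1) \in T.
Hypothesis T_div : forall s t,
  s \in T -> t \in T -> (s.1 * t.1^-1, s.2 * t.2^-1) \in T.
(** Together with [T_div] this makes [T] the graph of an injective map; see [T_inj]. *)
Hypothesis T_eq1 : forall t, t \in T -> (t.1 == 1) = (t.2 == 1).

(** The form in which high core-freeness enters, for Sigma if [b] is true and for theta(Sigma)
    otherwise. *)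
Hypothesis T_hcf : forall b (F P : seq H), 1 \notin P ->
  exists h, h \notin F /\ forall t, t \in T -> h^-1 * side b t * h \notin P.
Hypothesis R_enum : exists r : nat -> R, forall x, exists n, r n = x.

Let aK g : cancel (a g) (a g^-1).
Proof. by move=> x; rewrite -aM mulVg a1. Qed.

Let aVK g : cancel (a g^-1) (a g).
Proof. by move=> x; rewrite -aM mulgV a1. Qed.

Let a_inj g : injective (a g).
Proof. exact: can_inj (aK g). Qed.

Let a_eq1 g x : (a g x == x) = (g == 1).
Proof. by apply/eqP/eqP => [/a_free|->]. Qed.

Let T_inv t : t \in T -> (t.1^-1, t.2^-1) \in T.
Proof. by move=> tT; have := T_div T1 tT; rewrite /= !mul1g. Qed.

Let T_mul s t : s \in T -> t \in T -> (s.1 * t.1, s.2 * t.2) \in T.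
Proof. by move=> sT /T_inv tT; have := T_div sT tT; rewrite /= !invgK. Qed.

Let T_side1 b t : t \in T -> (side b t == 1) = (side (~~ b) t == 1).
Proof. by case: b => /T_eq1 ->. Qed.

Let T_inj b s t : s \in T -> t \in T -> side b s = side b t -> s = t.
Proof.
move=> sT tT st; have := T_eq1 (T_div sT tT).
case: b s t sT tT st => -[s1 s2] [t1 t2] sT tT /= <-; rewrite mulgV eqxx.
  by move=> /esym/eqP/divg1_eq ->.
by move=> /eqP/divg1_eq ->.
Qed.

Definition tact (t : H * H) (p : R * R) : R * R := (a t.1 p.1, a t.2 p.2).

Lemma side_tact b t p : side b (tact t p) = a (side b t) (side b p).
Proof. by case: b. Qed.

Definition orb (l : seq (R * R)) := [seq tact t p | t <- T, p <- l].

Lemma orbP q l : reflect (exists t p, [/\ t \in T, p \in l & q = tact t p]) (q \in orb l).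
Proof.
apply: (iffP allpairsP) => [[[t p] [tT pl ->]]|[t [p [tT pl ->]]]].
  by exists t, p.
by exists (t, p).
Qed.

(** The clause on equalities makes pairwise compatible pairs the graph of an injective partial
    map. *)
Definition compatible (p q : R * R) : Prop :=
  (p.1 == q.1) = (p.2 == q.2) /\ E p.1 q.1 = E p.2 q.2.

Lemma compatible_sym p q : compatible p q -> compatible q p.
Proof.
by case=> h1 h2; split; [rewrite eq_sym h1 eq_sym|rewrite E_sym h2 E_sym].
Qed.

Lemma compatible_tact t p q : compatible (tact t p) (tact t q) <-> compatible p q.
Proof. by rewrite /compatible /= !(inj_eq (@a_inj _)) !E_act. Qed.

(* [G] is the graph of an equivariant finite partial isomorphism. *)
Definition good (G : seq (R * R)) : Prop :=
  (forall t p, t \in T -> p \in G -> tact t p \in G) /\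
  {in G &, forall p q, compatible p q}.

(** [T] is a group acting diagonally and preserving compatibility, so a pair of elements of orbits
    can be translated until one of them is a representative in [l]. *)
Lemma good_cat G l : good G ->
  {in l & G, forall p q, compatible p q} ->
  {in l &, forall p q t, t \in T -> compatible p (tact t q)} ->
  good (G ++ orb l).
Proof.
move=> [GT Gc] lG ll.
have tactM s t p : tact s (tact t p) = tact (s.1 * t.1, s.2 * t.2) p.
  by rewrite /tact /= !aM.
have tactK t p q : tact t p = q -> p = tact (t.1^-1, t.2^-1) q.
  by move=> <-; rewrite /tact /= !aK; case: p.
have orbG : {in orb l & G, forall p q, compatible p q}.
  move=> _ q /orbP[t [p [tT pl ->]]] qG.
  have -> : q = tact t (tact (t.1^-1, t.2^-1) q).
    by rewrite tactM /= !mulgV /tact /= !a1; case: (q).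
  by apply/compatible_tact/lG => //; apply: GT => //; exact: T_inv.
split=> [t p tT|p q]; rewrite !mem_cat.
  case/orP => [pG|/orbP[s [q [sT ql ->]]]]; first by rewrite GT.
  rewrite tactM; apply/orP; right; apply/orbP.
  by exists (t.1 * s.1, t.2 * s.2), q; split => //; exact: T_mul.
case/orP => pG /orP[] qG; [exact: Gc|exact/compatible_sym/orbG|exact: orbG|].
case/orbP: pG qG => s [{}p [sT pl ->]] /orbP[t [{}q [tT ql ->]]].
have -> : tact t q = tact s (tact (s.1^-1 * t.1, s.2^-1 * t.2) q).
  by rewrite tactM /= !mulVKg; case: (t).
by apply/compatible_tact/ll => //; have := T_mul (T_inv sT) tT.
Qed.

Lemma sub_orb l : {subset l <= orb l}.
Proof. by move=> p pl; apply/orbP; exists (1, 1), p; rewrite /tact /= !a1; case: (p) pl. Qed.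

(** The image [z] of [x] is a point in a new orbit, joined to the images of the neighbours of [x]
    and to its own [T]-translates exactly as [x] is to its own. *)
Lemma point_ext b G x (V : seq R) : good G -> x \notin [seq side b p | p <- G] ->
  exists z, good (G ++ orb [:: mkpair b x z]) /\ (forall v h, v \in V -> a h z != v).
Proof.
move=> gG xG.
pose U := [seq side (~~ b) p | p <- G & E x (side b p)].
pose P := [seq side (~~ b) t | t <- T & E x (a (side b t) x)].
have [z [zV zU zP]] := E_ext U ([seq side (~~ b) p | p <- G] ++ V) P.
have compI p q : (side b p == side b q) = (side (~~ b) p == side (~~ b) q) ->
    E (side b p) (side b q) = E (side (~~ b) p) (side (~~ b) q) -> compatible p q.
  by rewrite /compatible; case: (b) => /= -> ->.
exists z; split; last by move=> v h vV; apply: zV; rewrite mem_cat vV orbT.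
apply: good_cat => // [p q|p q].
  rewrite inE => /eqP -> qG.
  have qV : side (~~ b) q \in [seq side (~~ b) p | p <- G] ++ V.
    by rewrite mem_cat map_f.
  apply: compI; rewrite side_mkpair side_mkpairN.
    have /negbTE := zV _ 1 qV; rewrite a1 => ->.
    by apply: contraNF xG => /eqP ->; exact: map_f.
  rewrite zU //; apply/idP/mapP => [xq|[r]].
    by exists q; rewrite // mem_filter xq.
  rewrite mem_filter => /andP[xr rG] qr.
  have [e _] := gG.2 _ _ rG qG.
  (* [q] and [r] agree on one side, hence on the other, since [G] is the graph of an injection. *)
  suff -> : side b q = side b r by [].
  by apply/esym/eqP; move: e qr; case: (b) => /= e qr; [rewrite e|rewrite -e]; rewrite qr.
rewrite !inE => /eqP -> /eqP -> t tT.
have memP s : s \in T -> (side (~~ b) s \in P) = E x (a (side b s) x).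
  move=> sT; apply/mapP/idP => [[r]|xs]; last by exists s; rewrite // mem_filter xs.
  by rewrite mem_filter => /andP[xr rT] /(T_inj sT rT) ->.
apply: compI; rewrite !side_tact !side_mkpair !side_mkpairN.
  by rewrite eq_sym a_eq1 [RHS]eq_sym a_eq1 T_side1.
rewrite zP memP //.
(* The symmetrisation in [E_ext] is harmless: translating by s turns an edge from [x] to s^-1 [x]
   into one from s [x] to [x]. *)
have -> : (side (~~ b) t)^-1 = side (~~ b) (t.1^-1, t.2^-1) by case: (b).
rewrite memP; last exact: T_inv.
have -> : side b (t.1^-1, t.2^-1) = (side b t)^-1 by case: (b).
rewrite -[in X in _ || X](E_act (side b t)) aVK [in X in _ || X]E_sym orbb -T_side1 //.
by case: eqP => //= ->; rewrite a1 E_irr.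
Qed.

Definition near (x y : R) := (x == y) || E x y.

Lemma near_act g x y : near (a g x) (a g y) = near x y.
Proof. by rewrite /near (inj_eq (@a_inj g)) E_act. Qed.

Lemma far_compatible p q : ~~ near p.1 q.1 -> ~~ near p.2 q.2 -> compatible p q.
Proof.
by rewrite /near !negb_or /compatible => /andP[/negbTE-> /negbTE->] /andP[/negbTE-> /negbTE->].
Qed.

Lemma near_finite (L D : seq R) : exists F : seq H,
  forall u v h, u \in L -> v \in D -> near (a h u) v -> h \in F.
Proof.
have [f fP] := choice (fun uv : R * R => E_fin uv.1 uv.2).
exists (flatten [seq f uv | uv <- [seq (u, v) | u <- L, v <- D]]) => u v h uL vD huv.
apply/flatten_mapP; exists (u, v); last exact: fP.
exact: allpairs_f.
Qed.

(** Finitely many elements bring [L] near [D] or near itself. Choose [h] outside the first set and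
    such that conjugation by [h] takes the nontrivial elements of the subgroup outside the
    second. *)
Lemma spread b (L D : seq R) : exists h,
  {in L & D, forall u v, ~~ near (a h u) v} /\
  {in L &, forall u v t, t \in T -> t.1 != 1 ->
    ~~ near (a h u) (a (side b t) (a h v))}.
Proof.
have [F FP] := near_finite L D; have [P PP] := near_finite L L.
(* Discarding 1 loses nothing: a conjugate of a nontrivial element is nontrivial. *)
have P1 : 1 \notin [seq h <- P | h != 1] by rewrite mem_filter eqxx.
have [h [hF hP]] := T_hcf b F P1.
exists h; split=> [u v uL vD|u v uL vL t tT t1].
  by apply: contra hF; exact: FP.
(* The inverse appears because h u is near s h v exactly when h^-1 s^-1 h u is near v. *)
have := hP _ (T_inv tT); apply: contra => huv.
have -> : side b (t.1^-1, t.2^-1) = (side b t)^-1 by case: (b).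
rewrite mem_filter; apply/andP; split; last first.
  apply: (PP u v) => //.
  by rewrite !aM -(near_act h) aVK -(near_act (side b t)) aVK.
apply: contra t1; rewrite -mulgA -conjgE conjg_eq1 invg_eq1.
by case: (b) => //; rewrite T_eq1.
Qed.

(** After spreading domain and range apart by [h] and [k], every compatibility to check is between
    far points on both sides, except inside a single translate of [l], where it is the hypothesis on
    [l]. *)
Lemma extend_iso G (l : seq (R * R)) : good G -> {in l &, forall p q, compatible p q} ->
  exists G' h k, [/\ good G', {subset G <= G'} &
    forall p, p \in l -> (a h p.1, a k p.2) \in G'].
Proof.
move=> gG lc.
have [h [hG hl]] := spread true [seq p.1 | p <- l] [seq p.1 | p <- G].
have [k [kG kl]] := spread false [seq p.2 | p <- l] [seq p.2 | p <- G].
pose l' := [seq (a h p.1, a k p.2) | p <- l].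
exists (G ++ orb l'), h, k; split=> [|p pG|p pl].
- apply: good_cat => // [_ q /mapP[p pl ->] qG|_ _ /mapP[p pl ->] /mapP[q ql ->] t tT].
    by apply: far_compatible; [apply: hG|apply: kG]; exact: map_f.
  have [t1|t1] := eqVneq t.1 1; last first.
    by apply: far_compatible; [apply: hl|apply: kl]; rewrite ?map_f // -?T_eq1.
  have t2 : t.2 = 1 by apply/eqP; rewrite -T_eq1 // t1.
  rewrite /compatible /= t1 t2 !a1 !(inj_eq (@a_inj _)) !E_act.
  exact: lc.
- by rewrite mem_cat pG.
- by rewrite mem_cat sub_orb ?orbT //; apply/mapP; exists p.
Qed.

Definition extends (w : bool -> R -> R) (G : seq (R * R)) : Prop :=
  forall b p, p \in G -> w b (side b p) = side (~~ b) p.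

(** A dense requirement, in the sense of forcing or of Baire category. *)
Definition forceable (Q : (bool -> R -> R) -> Prop) : Prop :=
  forall G, good G -> exists G', [/\ good G', {subset G <= G'} &
    forall w, extends w G' -> Q w].

Lemma forceable_iso (l : seq (R * R)) : {in l &, forall p q, compatible p q} ->
  forceable (fun w => exists h k, forall p, p \in l -> w true (a h p.1) = a k p.2).
Proof.
move=> lc G /extend_iso/(_ lc)[G' [h [k [gG' GG' lG']]]].
exists G'; split=> // w wG'; exists h, k => p /lG'; exact: wG' true _.
Qed.

(* The list [:: (b1, k1); ...; (bn, kn)] stands for the element
   t^b1 k1 ... t^bn kn, where t^true = t and t^false = t^-1. *)
Fixpoint path_act (w : bool -> R -> R) (s : seq (bool * H)) (x : R) : R :=
  if s is (b, k) :: s' then w b (a k (path_act w s' x)) else x.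

(** The excluded patterns are the pinches of Britton's lemma: t s t^-1 with s in Sigma, and t^-1 s t
    with s in theta(Sigma). *)
Fixpoint reduced (s : seq (bool * H)) : Prop :=
  if s is (b, k) :: s' then
    (if s' is (b', _) :: _ then b' = ~~ b -> k \notin [seq side b t | t <- T]
     else True) /\ reduced s'
  else True.

(** Induction on [s], whose head is the letter applied last. The invariant is that the H-orbit of
    the endpoint [y] meets [G'] only on the side where that letter is undone, and there only in
    translates of [y] by the associated subgroup. *)
Lemma fresh_path s G : reduced s -> good G -> exists G' x y,
  [/\ good G', {subset G <= G'},
      forall w, extends w G' -> path_act w s x = y,
      forall b h p, p \in G' -> side b p = a h y ->
        if s is (b', _) :: _ then b = ~~ b' /\ h \in [seq side b t | t <- T]
        else False
    & s <> [::] -> forall h, a h y != x].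
Proof.
move=> + gG; elim: s => [_|[b k] s IHs /= [sk /IHs[G' [x [y [gG' GG' pth fr _]]]]]].
  have [y [yV _ _]] := E_ext [::] ([seq p.1 | p <- G] ++ [seq p.2 | p <- G]) [::].
  exists G, y, y; split=> // b h p pG py.
  apply: (negP (yV (side b p) h _)); last by rewrite py.
  by rewrite mem_cat; case: (b) => /=; rewrite map_f ?orbT.
(* Were the next letter already defined at [a k y], the invariant would exhibit a pinch in the
   word. *)
have ky : a k y \notin [seq side b p | p <- G'].
  apply/mapP => -[p pG' /esym py]; have := fr _ _ _ pG' py.
  case: s sk {IHs pth fr} => // -[b' k'] s sk [bb' kT].
  have b'b : b' = ~~ b by rewrite bb' negbK.
  by have := sk b'b; rewrite kT.
(* Avoiding the orbit of [x] separates the endpoint from the start; avoiding those of [a k y] and of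
   [G'] restores the invariant. *)
pose V := x :: a k y :: [seq p.1 | p <- G'] ++ [seq p.2 | p <- G'].
have [z [gz zV]] := point_ext V gG' ky.
exists (G' ++ orb [:: mkpair b (a k y) z]), x, z; split=> // [p /GG' pG|w wG|c h p|_ h].
- by rewrite mem_cat pG.
- have wG' : extends w G' by move=> c p pG; apply: wG; rewrite mem_cat pG.
  have := wG b (mkpair b (a k y) z); rewrite side_mkpair side_mkpairN pth //.
  by apply; rewrite mem_cat sub_orb ?orbT // mem_head.
- rewrite mem_cat => /orP[pG pz|/orbP[t [q [tT]]]].
    exfalso; apply: (negP (zV (side c p) h _)); last by rewrite pz.
    by rewrite !inE mem_cat; case: (c) => /=; rewrite map_f ?orbT.
  rewrite inE => /eqP -> ->; rewrite side_tact.
  have [->|cb] := eqVneq c b.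
    rewrite side_mkpair => /(congr1 (a (side b t)^-1)); rewrite aK -aM => /esym/eqP.
    by rewrite (negbTE (zV _ _ _)) // !inE eqxx orbT.
  have {cb}-> : c = ~~ b by case: (c) (b) cb => -[].
  rewrite side_mkpairN => /(congr1 (a h^-1)) /eqP.
  by rewrite aK -aM a_eq1 mulg_eq1 eqg_inv => /eqP ->; rewrite map_f.
- by apply: zV; rewrite mem_head.
Qed.

Lemma forceable_path s h : s <> [::] -> reduced s ->
  forceable (fun w => exists x, a h (path_act w s x) <> x).
Proof.
move=> s0 /fresh_path sP G /sP[G' [x [y [gG' GG' pth _ /(_ s0 h)/eqP xy]]]].
by exists G'; split=> // w /pth wx; exists x; rewrite wx.
Qed.

(** Back and forth: stage n puts [r n] in the domain and in the range and forces [Q n]. The union of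
    the stages is an automorphism, with [w false] as inverse of [w true]. *)
Lemma generic_extension (Q : nat -> (bool -> R -> R) -> Prop) :
  (forall n, forceable (Q n)) ->
  exists w : bool -> R -> R,
    [/\ forall b, cancel (w b) (w (~~ b)),
        forall t x, t \in T -> w true (a t.1 x) = a t.2 (w true x),
        forall x y, E (w true x) (w true y) = E x y
      & forall n, Q n w].
Proof.
move=> fQ; have [r rP] := R_enum.
have side_ext b x G : good G -> exists G',
    [/\ good G', {subset G <= G'} & x \in [seq side b p | p <- G']].
  move=> gG; case xG : (x \in [seq side b p | p <- G]); first by exists G; split=> // p.
  have [z [gz _]] := point_ext [::] gG (negbT xG).
  exists (G ++ orb [:: mkpair b x z]); split=> // [p pG|]; first by rewrite mem_cat pG.
  apply/mapP; exists (mkpair b x z); rewrite ?side_mkpair //.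
  by rewrite mem_cat sub_orb ?orbT // mem_head.
(* Goodness is a premise inside the existential, with [[::]] as default, so that choice yields a
   total function that can be iterated. *)
have step (nG : nat * seq (R * R)) : exists G', good nG.2 ->
    [/\ good G', {subset nG.2 <= G'}, forall b, r nG.1 \in [seq side b p | p <- G']
      & forall w, extends w G' -> Q nG.1 w].
  have [gG|] := pselect (good nG.2); last by exists [::].
  have [G1 [g1 s1 r1]] := side_ext true (r nG.1) _ gG.
  have [G2 [g2 s2 r2]] := side_ext false (r nG.1) _ g1.
  have [G3 [g3 s3 q3]] := fQ nG.1 _ g2.
  exists G3 => _; split=> // [p /s1/s2/s3 //|[]].
    by have /mapP[p /s2/s3 ? ->] := r1; exact: map_f.
  by have /mapP[p /s3 ? ->] := r2; exact: map_f.
have [f fP] := choice step.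
pose Gs := fix Gs n := if n is n'.+1 then f (n', Gs n') else [::].
have gGs n : good (Gs n) by elim: n => // n IHn; have [] := fP (n, Gs n) IHn.
have Gs_step n := fP (n, Gs n) (gGs n).
have Gs_mono m n : (m <= n)%N -> {subset Gs m <= Gs n}.
  move=> /subnK <-; elim: (n - m)%N => // d IHd p /IHd.
  by have [_ + _ _] := Gs_step (d + m)%N; apply.
have joint m n p q : p \in Gs m -> q \in Gs n -> compatible p q.
  move=> pm qn; apply: (gGs (maxn m n)).2.
    exact: (Gs_mono _ _ (leq_maxl m n)).
  exact: (Gs_mono _ _ (leq_maxr m n)).
have total (bx : bool * R) : exists y, exists n, mkpair bx.1 bx.2 y \in Gs n.
  case: bx => b x; have [n <-] := rP x.
  have [_ _ /(_ b)/mapP[p pG ->] _] := Gs_step n.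
  by exists (side (~~ b) p), n.+1; case: b p pG => -[].
have [w0 w0P] := choice total; pose w b x := w0 (b, x).
have wP b x : exists n, mkpair b x (w b x) \in Gs n := w0P (b, x).
(* The values were chosen without regard to the stage; compatibility across stages forces them to
   agree with every stage. *)
have wGs n : extends w (Gs n).
  move=> b p pG; have [m wm] := wP b (side b p).
  have [e _] := joint _ _ _ _ wm pG.
  by apply/eqP; move: e; case: (b) => /=; rewrite eqxx.
exists w; split=> [b x|t x tT|x y|n].
- have [n /(wGs n (~~ b))] := wP b x.
  by rewrite side_mkpairN negbK side_mkpair.
- by have [n /((gGs n).1 _ _ tT)/(wGs _ true)] := wP true x.
- have [n xn] := wP true x; have [m ym] := wP true y.
  by have [_] := joint _ _ _ _ xn ym.
- by have [_ _ _] := Gs_step n; apply; exact: wGs n.+1.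
Qed.

End PartialIsomorphisms.

(** * High core-freeness of finite subgroups *)

(** Otherwise the sets [S x] of those h whose conjugate h^-1 A h contains x, for x in [P], cover the
    complement of A F. One of them has trivial core; but x lies in the core of [S x], so 1 would be
    in [P]. *)
Lemma highly_core_free_avoid (H : groupType) (A : set H) :
  infinite_set [set: H] -> A 1 -> finite_set A -> highly_core_free A ->
  forall F P : seq H, 1 \notin P ->
    exists h, h \notin F /\ forall s, A s -> h^-1 * s * h \notin P.
Proof.
move=> Hinf A1 Afin Ahcf F P P1; apply: contrapT => noh.
pose S x := [set h | exists2 s, A s & x = h^-1 * s * h].
pose AF := [set s * f | s in A & f in [set` F]].
have AFfin : finite_set AF by exact: finite_image2.
have cover h : ~ AF h -> exists2 x, x \in P & S x h.
  move=> AFh; apply: contrapT => noS; apply: noh; exists h; split.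
    by apply/negP => hF; apply: AFh; exists 1 => //; exists h; rewrite ?mul1g.
  by move=> s As; apply/negP => sP; apply: noS; exists (h^-1 * s * h) => //; exists s.
(* High core-freeness speaks of non-empty sets only. *)
pose Q := [seq x <- P | `[< S x !=set0 >]].
(* A point outside the finite set [AF] ensures that the cover has at least one member. *)
have [h0 AFh0] : exists h, ~ AF h.
  apply: contrapT => nAF; apply: Hinf; apply: sub_finite_set AFfin => h _.
  by apply: contrapT => AFh; apply: nAF; exists h.
have inQ x h : x \in P -> S x h -> x \in Q.
  by move=> xP Sxh; rewrite mem_filter xP andbT; apply/asboolP; exists h.
have QP (k : 'I_(size Q)) : nth 1 Q k \in Q by rewrite mem_nth.
have [] := Ahcf [set` F] (size Q) (fun k => S (nth 1 Q k)).
- exact: finite_seq.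
- have [x xP xh] := cover _ AFh0.
  by have := inQ _ _ xP xh; case: Q {inQ QP}.
- by move=> k; have := QP k; rewrite mem_filter => /andP[/asboolP].
- move=> h /cover[x xP xh]; have xQ := inQ _ _ xP xh.
  by exists (Ordinal (etrans (index_mem x Q) xQ)) => //=; rewrite nth_index.
move=> k core1.
have : core (S (nth 1 Q k)) A (nth 1 Q k).
  by move=> h [s As ->]; exists s.
rewrite core1 => /= Qk; have := QP k.
by rewrite Qk mem_filter (negbTE P1) andbF.
Qed.

(** * Countability and enumerations *)

Lemma countable_seq (T : Type) : countable [set: T] -> countable [set: seq T].
Proof. by move=> /Pcountable[C ->]; exact: countableP. Qed.

Lemma countable_sum (T U : Type) :
  countable [set: T] -> countable [set: U] -> countable [set: T + U].
Proof. by move=> /Pcountable[C ->] /Pcountable[D ->]; exact: countableP. Qed.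

Lemma countable_prod (T U : Type) :
  countable [set: T] -> countable [set: U] -> countable [set: T * U].
Proof. by move=> /Pcountable[C ->] /Pcountable[D ->]; exact: countableP. Qed.

Lemma injective_nat_unbounded (f : nat -> nat) m : injective f -> exists k, (m <= f k)%N.
Proof.
move=> f_inj; apply: contrapT => nf.
have fm k : (f k < m)%N by rewrite ltnNge; apply/negP => mf; apply: nf; exists k.
suff : (m.+1 <= m)%N by rewrite ltnn.
rewrite -{1}(size_iota 0 m.+1) -(size_map f) -{2}(size_iota 0 m).
apply: uniq_leq_size; first by rewrite map_inj_uniq ?iota_uniq.
by move=> _ /mapP[k _ ->]; rewrite mem_iota fm.
Qed.

(** Enumerating pairs of an element and a counter makes every element recur; [x0] fills the indices
    coding no pair. *)
Lemma countable_enum_often (T : Type) (x0 : T) : countable [set: T] ->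
  exists e : nat -> T, forall c m, exists2 n, (m <= n)%N & e n = c.
Proof.
move=> /Pcountable[C TC]; subst T.
exists (fun n => if @unpickle (C * nat)%type n is Some (c, _) then c else x0) => c m.
have [|k mk] := @injective_nat_unbounded (fun k => pickle (c, k)) m.
  by move=> i j /(pcan_inj pickleK)[].
by exists (pickle (c, k)) => //; rewrite pickleK.
Qed.

(** * A random graph with a free action of H *)

(* [(e n).1] prescribes the neighbours of (1, n) in the orbits of smaller index,
   [(e n).2] those in its own orbit. *)
Section HomogeneousGraph.
Variables (H : groupType) (e : nat -> seq (H * nat) * seq H).
Hypothesis e_often : forall c m, exists2 n, (m <= n)%N & e n = c.

Definition vact (h : H) (x : H * nat) : H * nat := (h * x.1, x.2).

Definition down_nbrs n : seq (H * nat) := (e n).1 ++ [seq (p, n) | p <- (e n).2].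

(** Multiplying by [x.1^-1] moves [x] to [(1, x.2)], which makes the relation invariant under H. *)
Definition down_adj (x y : H * nat) : bool :=
  [&& (y.2 <= x.2)%N, x != y & (x.1^-1 * y.1, y.2) \in down_nbrs x.2].

Definition vadj (x y : H * nat) : bool := down_adj x y || down_adj y x.

Lemma vact1 x : vact 1 x = x.
Proof. by rewrite /vact mul1g; case: x. Qed.

Lemma vactM g h x : vact (g * h) x = vact g (vact h x).
Proof. by rewrite /vact mulgA. Qed.

Lemma vact_free g x : vact g x = x -> g = 1.
Proof. by case: x => x i [/(canRL (mulgK x))]; rewrite mulgV. Qed.

Lemma vadj_sym : symmetric vadj.
Proof. by move=> x y; rewrite /vadj orbC. Qed.

Lemma vadj_irr : irreflexive vadj.
Proof. by move=> x; rewrite /vadj /down_adj eqxx !andbF. Qed.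

Lemma vadj_act g x y : vadj (vact g x) (vact g y) = vadj x y.
Proof.
have gE u v : (vact g u == vact g v) = (u == v).
  by rewrite -!pair_eqE /pair_eq /= (inj_eq (mulgI g)).
by rewrite /vadj /down_adj !gE /= !invgM !mulgA !mulgVK.
Qed.

(** An edge is recorded in the finite list of the larger of the two indices, and the entry recording
    it determines [h]. *)
Lemma vadj_finite u v : exists F : seq H,
  forall h, (vact h u == v) || vadj (vact h u) v -> h \in F.
Proof.
case: u v => [x i] [y j].
exists (y * x^-1 :: [seq y * p.1^-1 * x^-1 | p <- down_nbrs i]
                 ++ [seq y * p.1 * x^-1 | p <- down_nbrs j]) => h.
rewrite inE mem_cat => /or3P[/eqP[<- _]|/and3P[_ _ /= hd]|/and3P[_ _ /= hd]].
- by rewrite mulgK eqxx.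
- apply/or3P/Or32/mapP; exists ((h * x)^-1 * y, j) => //=.
  by rewrite invgM invgK mulVKg mulgK.
- apply/or3P/Or33/mapP; exists (y^-1 * (h * x), i) => //=.
  by rewrite mulVKg mulgK.
Qed.

Lemma vadj_ext (U V : seq (H * nat)) (P : seq H) : exists z,
  [/\ forall v h, v \in V -> vact h z != v,
      forall v, v \in V -> vadj z v = (v \in U)
    & forall h, vadj z (vact h z) = (h != 1) && ((h \in P) || (h^-1 \in P))].
Proof.
(* As the value [(U, P)] recurs, it is taken at an index above all those in [U] and [V]; then
   [(1, n)] controls its edges to all of [V]. *)
have [n] := e_often (U, P) (\max_(p <- U ++ V) p.2).+1 => maxn en.
have ltn p : p \in U ++ V -> (p.2 < n)%N.
  by move=> pUV; apply: leq_trans maxn; exact: leq_bigmax_seq.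
have nP q : q \in [seq (p, n) | p <- P] -> q.2 = n by move=> /mapP[? _ ->].
have memn h : ((h, n) \in down_nbrs n) = (h \in P).
  rewrite /down_nbrs en mem_cat /= mem_map; last by move=> ? ? [].
  case hU: (_ \in U) => //=.
  by have := ltn (h, n); rewrite mem_cat hU /= ltnn => /(_ isT).
exists (1, n); split=> [v h vV|v vV|h].
- have := ltn v; rewrite mem_cat vV orbT => /(_ isT) vn.
  by apply/eqP => zv; rewrite -zv ltnn in vn.
- have := ltn v; rewrite mem_cat vV orbT => /(_ isT) vn.
  have zv : (1, n) != v by apply/eqP => zv; rewrite -zv ltnn in vn.
  rewrite /vadj /down_adj /= (leqNgt n) vn orbF ltnW //= zv invg1 mul1g.
  rewrite /down_nbrs en mem_cat -surjective_pairing /=.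
  case: (v \in U) => //=; apply/negP => /nP vn'.
  by rewrite vn' ltnn in vn.
- rewrite /vadj /down_adj /= leqnn /= invg1 mul1g !mulg1 !memn.
  by rewrite -!pair_eqE /pair_eq /= eqxx !andbT eq_sym -andb_orr mulg1.
Qed.

Definition vgraph : simple_graph :=
  @SimpleGraph (H * nat)%type vadj (fun x y => etrans (vadj_sym y x))
    (fun x => elimF idP (vadj_irr x)).

Lemma vgraph_random : countable [set: H] -> is_random_graph vgraph.
Proof.
move=> Hc; split.
  apply: eq_card_nat; first exact: countable_prod.
  move=> /(finite_image (@snd H nat)) fin; apply: infinite_nat; apply: sub_finite_set fin => n _.
  by exists (1, n).
move=> U W /finite_seqP[s ->] /finite_seqP[t ->] UW0.
have [z [zV zU _]] := vadj_ext s (s ++ t) [::].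
exists z; split=> [zst|u /= us|w /= wt].
- have /negP[] := zV z 1 (etrans (mem_cat _ _ _) (introT orP zst)).
  by rewrite vact1.
- by rewrite /= zU // mem_cat us.
- rewrite /= zU ?mem_cat ?wt ?orbT // => ws.
  by rewrite -[False]/(set0 w) -UW0.
Qed.

End HomogeneousGraph.

(** * The action of words on the vertices *)

Section WordAction.
Variables (H : groupType) (R : Type) (a : H -> R -> R) (w : bool -> R -> R).

Definition letter_act (c : H + bool) : R -> R :=
  match c with inl h => a h | inr b => w b end.

Definition word_act (u : hnn_word H) (x : R) : R := foldr letter_act x u.

Lemma word_act_cat u v x : word_act (u ++ v) x = word_act u (word_act v x).
Proof. exact: foldr_cat. Qed.

Hypothesis a1 : forall x, a 1 x = x.
Hypothesis aM : forall g h x, a (g * h) x = a g (a h x).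
Hypothesis wK : forall b, cancel (w b) (w (~~ b)).
Variables (Sigma : set H) (theta : H -> H).
Hypothesis w_conj : forall s x, Sigma s -> w true (a s x) = a (theta s) (w true x).

(** This lets the action of words descend to the HNN extension. *)
Lemma word_act_cong u v :
  hnn_cong Sigma theta u v -> forall x, word_act u x = word_act v x.
Proof.
elim=> {u v} //= [v u v' _ IHu _ IHv x|u u' v v' _ IHu _ IHv x|x|x|s Ss x].
- by rewrite IHu.
- by rewrite !word_act_cat IHv IHu.
- exact: wK false x.
- exact: wK true x.
- by rewrite w_conj // (wK false).
Qed.

End WordAction.

(** * Reduced forms in the HNN extension *)

Section ReducedForm.
Variables (H : groupType) (Sigma : set H) (theta : H -> H) (T : seq (H * H)).
Hypothesis TP : forall t, t \in T -> Sigma t.1 /\ t.2 = theta t.1.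

Definition path_word (s : seq (bool * H)) : hnn_word H :=
  flatten [seq [:: inr bk.1; inl bk.2] | bk <- s].

Lemma word_act_path (R : choiceType) (a : H -> R -> R) w s x :
  word_act a w (path_word s) x = path_act a w s x.
Proof. by elim: s => [|[b k] s IHs] //=; rewrite IHs. Qed.

Local Notation cong := (hnn_cong Sigma theta).

Let congl u v x : cong u v -> cong (u ++ x) (v ++ x).
Proof. by move=> uv; apply: hnn_cat => //; exact: hnn_refl. Qed.

Let congr x u v : cong u v -> cong (x ++ u) (x ++ v).
Proof. by move=> uv; apply: hnn_cat => //; exact: hnn_refl. Qed.

Lemma cong_pinch b t : t \in T ->
  cong [:: inr b; inl (side b t); inr (~~ b)] [:: inl (side (~~ b) t)].
Proof.
move=> /TP[St t2]; case: b => /=; rewrite t2; first exact: hnn_conj.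
(* For t^-1, write theta s as t s t^-1 and cancel at both ends. *)
apply: hnn_trans (congl [:: inr true] (congr [:: inr false] (hnn_sym (hnn_conj _ St)))) _.
apply: hnn_trans (congl [:: inl t.1; inr false; inr true] (hnn_tVK _ _)) _.
exact: congr [:: inl t.1] _ _ (hnn_tVK _ _).
Qed.

(** Letters are added on the left, and a pinch created at the front is absorbed into the next
    element of H. That reduced words with a letter t or t^-1 are nontrivial will come from the
    action. *)
Lemma reduced_form u :
  exists h s, reduced T s /\ cong u (inl h :: path_word s).
Proof.
elim: u => [|[x|b] u [h [s [rs us]]]].
- exists 1, [::]; split => //; exact/hnn_sym/hnn_one.
- exists (x * h), s; split => //; apply: hnn_trans (congr [:: inl x] us) _.
  exact: congl _ (hnn_mul _ _ x h).
have push : cong (inr b :: u) (inl 1 :: path_word ((b, h) :: s)).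
  apply: hnn_trans (congr [:: inr b] us) _.
  exact: congl _ (hnn_sym (hnn_one _ _)).
case: s rs us push => [|[b' k] s] rs us push; first by exists 1, [:: (b, h)].
have [bb'|bb'] := eqVneq b' (~~ b); last first.
  exists 1, [:: (b, h), (b', k) & s]; split=> //; split=> // e.
  by rewrite e eqxx in bb'.
have [/mapP[t tT ht]|hT] := boolP (h \in [seq side b t | t <- T]); last first.
  by exists 1, [:: (b, h), (b', k) & s].
exists (side (~~ b) t * k), s; split; first by case: rs.
apply: hnn_trans (congr [:: inr b] us) _; rewrite ht bb'.
apply: hnn_trans (congl (inl k :: path_word s) (cong_pinch b tT)) _.
exact: congl _ (hnn_mul _ _ _ k).
Qed.

End ReducedForm.

(** * Assembling the action *)

(** Allows all finite data to be enumerated as tasks, those failing their premise being vacuous. *)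
Lemma forceable_imp (H : groupType) (R : choiceType) (a : H -> R -> R) (E : rel R)
  (T : seq (H * H)) (P : Prop) (Q : (bool -> R -> R) -> Prop) :
  (P -> forceable a E T Q) -> forceable a E T (fun w => P -> Q w).
Proof.
have [p|np] := pselect P => PQ G gG; last by exists G; split.
by have [G' [g' s' q']] := PQ p G gG; exists G'; split=> // w /q'.
Qed.

Theorem theoremB (H : groupType) (Sigma : set H) (theta : H -> H)
  (H_infinite : infinite_set [set: H])
  (H_countable : countable [set: H])
  (Sigma_subgroup : subgroup Sigma)
  (Sigma_finite : finite_set Sigma)
  (theta_morph : forall x y, Sigma x -> Sigma y ->
     theta (x * y) = theta x * theta y)
  (theta_inj : set_inj Sigma theta)
  (Sigma_hcf : highly_core_free Sigma)
  (theta_Sigma_hcf : highly_core_free (theta @` Sigma)) :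
  in_HR (hnn Sigma theta).
Proof.
have word_countable : countable [set: hnn_word H].
  exact: countable_seq (countable_sum H_countable (countableP _)).
split.
  have /countable_injP[f f_inj] := word_countable.
  apply/countable_injP; exists (fun g : hnn Sigma theta => f (repr g)) => x y _ _.
  by move=> /(f_inj _ _ (in_setT _) (in_setT _)) /(congr1 \pi_(hnn Sigma theta)); rewrite !reprK.
have V_countable : countable [set: H * nat].
  exact: countable_prod H_countable (countableP _).
have [e e_often] := countable_enum_often ([::], [::])
  (countable_prod (countable_seq V_countable) (countable_seq H_countable)).
have [S1 S_div] := Sigma_subgroup.
have theta1 : theta 1 = 1.
  by apply: (mulgI (theta 1)); rewrite -theta_morph // !mulg1.
have S_inv s : Sigma s -> Sigma s^-1.
  by move=> Ss; rewrite -[_^-1]mul1g; exact: S_div.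
have theta_inv s : Sigma s -> theta s^-1 = (theta s)^-1.
  move=> Ss; apply: (mulgI (theta s)); rewrite -theta_morph ?mulgV //; exact: S_inv.
have /finite_seqP[sg sgE] := Sigma_finite.
have memS s : s \in sg <-> Sigma s by rewrite sgE.
pose T := [seq (s, theta s) | s <- sg].
have TP t : t \in T -> Sigma t.1 /\ t.2 = theta t.1.
  by move=> /mapP[s /memS Ss ->].
have memT s : Sigma s -> (s, theta s) \in T by move=> /memS; exact: map_f.
have T1 : (1, 1) \in T by rewrite -{2}theta1 memT.
have T_div s t : s \in T -> t \in T -> (s.1 * t.1^-1, s.2 * t.2^-1) \in T.
  move=> /TP[Ss ->] /TP[St ->].
  by rewrite -theta_inv // -theta_morph ?memT //; [exact: S_div|exact: S_inv].
have T_eq1 t : t \in T -> (t.1 == 1) = (t.2 == 1).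
  move=> /TP[St ->]; apply/eqP/eqP => [->//|t1].
  by apply: theta_inj; rewrite ?inE // theta1.
have T_hcf b (F P : seq H) : 1 \notin P ->
    exists h, h \notin F /\ forall t, t \in T -> h^-1 * side b t * h \notin P.
  move=> P1; case: b.
    have [h [hF hP]] := highly_core_free_avoid H_infinite S1 Sigma_finite Sigma_hcf F P1.
    by exists h; split=> // t /TP[St _]; exact: hP.
  have tS1 : (theta @` Sigma) 1 by exists 1.
  have [h [hF hP]] := highly_core_free_avoid H_infinite tS1
    (finite_image theta Sigma_finite) theta_Sigma_hcf F P1.
  by exists h; split=> // t /TP[St t2]; apply: hP; exists t.1.
pose E := vadj e; pose a := @vact H.
have [r r_often] := countable_enum_often (1, 0%N) V_countable.
have R_enum : exists r : nat -> H * nat, forall x, exists n, r n = x.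
  by exists r => x; have [n _] := r_often x 0%N; exists n.
have a1 : forall x, a 1 x = x := @vact1 H.
have aM : forall g h x, a (g * h) x = a g (a h x) := @vactM H.
have a_free : forall g x, a g x = x -> g = 1 := @vact_free H.
have E_sym : symmetric E := vadj_sym e.
have E_irr : irreflexive E := vadj_irr e.
have E_act : forall g x y, E (a g x) (a g y) = E x y := vadj_act e.
have E_fin := vadj_finite e.
have E_ext := vadj_ext e_often.
(* Left: candidate finite partial isomorphisms, for homogeneity. Right: candidate reduced forms of
   group elements, for faithfulness. *)
pose task := (seq ((H * nat) * (H * nat)) + seq (bool * H) * H)%type.
have task_countable : countable [set: task].
  apply: countable_sum; first exact/countable_seq/countable_prod.
  exact/countable_prod/H_countable/countable_seq/countable_prod.
have [k k_often] := countable_enum_often (inl [::] : task) task_countable.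
pose Q n (w : bool -> H * nat -> H * nat) := match k n with
  | inl l => {in l &, forall p q, compatible E p q} ->
      exists h k, forall p, p \in l -> w true (a h p.1) = a k p.2
  | inr (s, h) => s <> [::] /\ reduced T s -> exists x, a h (path_act a w s x) <> x
  end.
have fQ n : forceable a E T (Q n).
  rewrite /Q; case: (k n) => [l|[s h]]; apply: forceable_imp.
    exact: forceable_iso.
  by case=> s0 rs; exact: forceable_path.
have [w [wK wT wE wQ]] : exists w : bool -> H * nat -> H * nat,
    [/\ forall b, cancel (w b) (w (~~ b)),
        forall t x, t \in T -> w true (a t.1 x) = a t.2 (w true x),
        forall x y, E (w true x) (w true y) = E x y
      & forall n, Q n w] by exact: generic_extension.
have w_conj s x : Sigma s -> w true (a s x) = a (theta s) (w true x).
  by move=> /memT/wT.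
have wE' b x y : E (w b x) (w b y) = E x y.
  by case: b => //; rewrite -wE !(wK false).
pose act (g : hnn Sigma theta) := word_act a w (repr g).
have actP u x : act (\pi u) x = word_act a w u x.
  exact: (word_act_cong a1 aM wK w_conj (hnn_repr _ _ u)).
exists (vgraph e), act; split; first exact: vgraph_random.
- split=> [x|g h x|g x y]; first exact: actP [::] x.
    by rewrite [in RHS]/act -word_act_cat; exact: actP.
  suff adj_eq : E (act g x) (act g y) = E x y.
    by change (E (act g x) (act g y) <-> E x y); rewrite adj_eq.
  rewrite /act; elim: (repr g) => //= -[h|b] u <-.
    exact: E_act.
  exact: wE'.
- move=> g g_triv; have [h [s [rs gs]]] := reduced_form TP (repr g).
  have hs x : a h (path_act a w s x) = x.
    by rewrite -[RHS]g_triv /act (word_act_cong a1 aM wK w_conj gs) /= word_act_path.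
  (* Without letters t or t^-1, freeness of the action of H gives [h] = 1; otherwise the task of
     this reduced form supplies a moved point. *)
  case: s rs gs hs => [_ gh /(_ (1, 0%N))/a_free h1|c s rs _ hs].
    rewrite -[g]reprK; apply/hnn_piP; rewrite h1 in gh.
    exact: hnn_trans gh (hnn_one _ _).
  have [n _ kn] := k_often (inr (c :: s, h)) 0%N.
  by have := wQ n; rewrite /Q kn => /(_ (conj _ rs))[|x] //; rewrite hs.
- move=> U W phi /finite_seqP[s ->] _ [_ phi_inj _] phi_adj.
  have [n _ kn] := k_often (inl [seq (u, phi u) | u <- s]) 0%N.
  have [h [h' hP]] : exists h h', forall p, p \in [seq (u, phi u) | u <- s] ->
      w true (a h p.1) = a h' p.2.
    have := wQ n; rewrite /Q kn; apply => _ _ /mapP[u us ->] /mapP[v vs ->].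
    split=> /=; last by apply/idP/idP => /(phi_adj _ _ us vs).
    apply/eqP/eqP => [->//|]; apply: phi_inj; exact: mem_set.
  exists (\pi [:: inl h'^-1; inr true; inl h]) => u us.
  rewrite actP /= (hP (u, phi u)) ?map_f //=.
  by rewrite -aM mulVg a1.
Qed.
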